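(* Let $r$ be a rational function of degree $N$, let $\alpha\in\Omega(r)$ and let $w_1(\alpha),\ldots,w_N(\alpha)$ be the (simple) roots of $r(z)=\alpha$. Let $f,g\in\mathfrak L(r)$. Then the sum $$\sum_{n=1}^N\frac{f(w_n(\alpha))\,g(w_n(\alpha))}{r'(w_n(\alpha))}$$ does not depend on $\alpha\in\Omega(r)$.
   Context: Standing assumption: $r=p/q$ with $p,q$ coprime polynomials, $\deg p\ge\deg q$, and $N=\deg p$. $\Omega(r)$ is the set of $\alpha\in\mathbb C$ such that $r(z)=\alpha$ has $N$ pairwise different roots. $\mathfrak L(r)$ is the linear span of the functions $z\mapsto\frac{r(z)-r(a)}{z-a}$, where $a$ runs through the points of analyticity of $r$. *)

(* Defs.v *)
From mathcomp Require Import all_boot all_order all_algebra.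
From mathcomp Require Import all_classical all_reals all_analysis.
From mathcomp.real_closed Require Export complex.
Import GRing.Theory Num.Theory.
Import numFieldNormedType.Exports.

Set Implicit Arguments.
Unset Strict Implicit.
Unset Printing Implicit Defensive.

Local Open Scope classical_set_scope.
Local Open Scope ring_scope.

(* MathComp-Analysis attaches the norm topology to the carrier of an abstract
   numeric field but not to the concrete type R[i]; the definitions are
   therefore given for an abstract C, to be used with C = R[i], R : realType. *)
Section RationalFunction.
Variable C : numClosedFieldType.
(* Numerator and denominator of r = p / q. *)
Variables p q : {poly C}.

(* Meaningful only where q.[z] != 0: elsewhere the value is the junk
   p.[z] / 0 = 0. *)
Definition ratval (z : C) : C := p.[z] / q.[z].

Definition ratder (z : C) : C := (ratval^`())%classic z.

Definition solutions (alpha : C) : set C :=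
  [set z | q.[z] != 0 /\ ratval z = alpha].

(* For p != 0, (size p).-1 is deg p. *)
Definition Omega : set C :=
  [set alpha | (solutions alpha #= `I_((size p).-1))%card].

(* r is defined and complex differentiable in a neighbourhood of a. *)
Definition analytic_at (a : C) : Prop :=
  \forall z \near a, q.[z] != 0 /\ derivable ratval z 1.

(* z |-> (r z - r a) / (z - a); the removable singularity at z = a is filled
   by continuity, with the value r' a. *)
Definition difference_quotient (a z : C) : C :=
  if z == a then ratder a else (ratval z - ratval a) / (z - a).

(* The span is taken among functions on the domain of r: the values of f at
   the zeros of q are left unconstrained. *)
Definition in_span (f : C -> C) : Prop :=
  exists s : seq (C * C),
    (forall ca, ca \in s -> analytic_at ca.2) /\
    (forall z, q.[z] != 0 ->
       f z = \sum_(ca <- s) ca.1 * difference_quotient ca.2 z).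

End RationalFunction.

(* Main.v *)
Require Import Defs.
From mathcomp Require Import all_boot all_order all_algebra.
From mathcomp Require Import all_classical all_reals all_analysis.
From mathcomp Require Import ring.
Import GRing.Theory Num.Theory.

Set Implicit Arguments.
Unset Strict Implicit.
Unset Printing Implicit Defensive.

(** Write [D_b] for the difference quotient of [r = p / q] at [b].  The bilinear
    form [B(f, g) = \sum_n f(w_n) g(w_n) / r'(w_n)] is independent of [alpha]
    because the [D_b] are reproducing kernels for it: [B(f, D_b) = f(b)] for
    every [f] in the span ([difference_quotient_reproducing]), whatever [alpha]
    is.  By linearity [B(f, \sum_b c_b D_b) = \sum_b c_b f(b)], where [alpha] no
    longer occurs.

    The reproducing property is Lagrange interpolation.  Every [f] in the span
    has the form [F / q] with [F] a polynomial of degree less than [N]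
    ([in_span_numerator]).  Put [P = p - alpha q], a polynomial of degree [N]
    whose roots are the [w_n], and let [P_n] be the cofactor [P / (X - w_n)].
    At the nodes one finds [r'(w_n) = P'(w_n) / q(w_n)] and
    [D_b(w_n) = P_n(b) / q(b)], so that [B(f, D_b)] equals
    [\sum_n F(w_n) P_n(b) / P'(w_n)] divided by [q(b)].  The sum is the Lagrange
    interpolation formula for [F(b)] ([lagrange_interpolation_cofactor]). *)

Local Open Scope classical_set_scope.
Local Open Scope ring_scope.
Local Open Scope complex_scope.

(** * Lagrange interpolation at the roots of a polynomial *)

Section LagrangeInterpolation.
Variables (F : fieldType) (n : nat) (w : 'I_n -> F).
Hypothesis w_inj : injective w.

Lemma poly_eq0_of_roots (Q : {poly F}) :
  (size Q <= n)%N -> (forall i, root Q (w i)) -> Q = 0.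
Proof.
move=> szQ rootQ; apply: (@roots_geq_poly_eq0 _ Q [seq w i | i <- enum 'I_n]).
- by apply/allP => _ /mapP[i _ ->].
- by rewrite map_inj_uniq ?enum_uniq.
- by rewrite size_map size_enum_ord.
Qed.

Variable P : {poly F}.
Hypotheses (P_neq0 : P != 0) (szP : (size P <= n.+1)%N).
Hypothesis w_rootP : forall i, root P (w i).

Definition cofactor_at (x : F) : {poly F} := P %/ ('X - x%:P).

Lemma cofactor_atK x : root P x -> cofactor_at x * ('X - x%:P) = P.
Proof. by rewrite -dvdp_XsubCl => /divpK. Qed.

Lemma horner_cofactor_at_deriv x : root P x -> (cofactor_at x).[x] = P^`().[x].
Proof.
move=> /cofactor_atK PE; rewrite -[in RHS]PE.
by rewrite derivM derivXsubC !hornerE subrr mulr0 add0r.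
Qed.

Lemma size_cofactor_at x : (size (cofactor_at x) <= n)%N.
Proof. by rewrite size_divp ?polyXsubC_eq0 // size_XsubC leq_subLR. Qed.

Lemma cofactor_at_eq0 i j : i != j -> (cofactor_at (w i)).[w j] = 0.
Proof.
move=> neq_ij; have := w_rootP j.
rewrite -{1}(cofactor_atK (w_rootP i)) rootM root_XsubC (inj_eq w_inj).
by rewrite [j == i]eq_sym (negPf neq_ij) orbF => /rootP.
Qed.

(** A multiple root would leave a cofactor that still vanishes at all [n]
    points although its degree is less than [n]. *)
Lemma deriv_neq0_at_roots i : P^`().[w i] != 0.
Proof.
rewrite -horner_cofactor_at_deriv //; apply: contraNneq P_neq0 => Qi0.
rewrite -(cofactor_atK (w_rootP i)) (@poly_eq0_of_roots (cofactor_at (w i))).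
- by rewrite mul0r.
- exact: size_cofactor_at.
- move=> j; rewrite /root; have [<-|neq_ij] := eqVneq i j; first exact/eqP.
  by rewrite cofactor_at_eq0.
Qed.

(** The two sides are polynomials in [b] of degree less than [n] which agree at
    the [n] nodes. *)
Lemma lagrange_interpolation_cofactor (G : {poly F}) (b : F) :
  (size G <= n)%N ->
  G.[b] = \sum_(i < n) G.[w i] / P^`().[w i] * (cofactor_at (w i)).[b].
Proof.
move=> szG.
pose L := \sum_(i < n) (G.[w i] / P^`().[w i]) *: cofactor_at (w i).
suff /eqP : G - L = 0.
  rewrite subr_eq0 => /eqP GL; rewrite [in LHS]GL horner_sum.
  by apply: eq_bigr => i _; rewrite hornerZ.
apply: poly_eq0_of_roots => [|j].
  rewrite (leq_trans (size_polyD _ _)) // geq_max szG size_polyN.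
  apply: (leq_trans (size_sum _ _ _)); apply/bigmax_leqP => i _.
  exact: leq_trans (size_scale_leq _ _) (size_cofactor_at _).
rewrite /root hornerD hornerN subr_eq0 horner_sum (bigD1 j) //= big1 => [|i].
  by rewrite addr0 hornerZ horner_cofactor_at_deriv // divfK
             ?deriv_neq0_at_roots.
by rewrite hornerZ => neq_ij; rewrite cofactor_at_eq0 // mulr0.
Qed.

End LagrangeInterpolation.

(** * Difference quotients of a rational function *)

Section RationalFunction.
Variable C : numClosedFieldType.
Import numFieldNormedType.Exports.

Lemma is_derive_horner (p : {poly C}) (x : C) :
  is_derive x (1 : C) (horner p) p^`().[x].
Proof.
elim/poly_ind: p => [|p c ihp].
  rewrite deriv0 horner0 (_ : horner 0 = cst 0); first exact: is_derive_cst.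
  by apply/funext => y; rewrite horner0.
rewrite (_ : horner _ = horner p * id + cst c); last first.
  by apply/funext => y; rewrite !hornerE.
apply: is_derive_eq; rewrite addr0 derivD derivM derivX derivC !hornerE /=.
by rewrite /GRing.scale /= mulr1 addrC [x * _]mulrC.
Qed.

Variables p q : {poly C}.

Lemma ratderE (z : C) : q.[z] != 0 ->
  ratder p q z = (p^`().[z] * q.[z] - p.[z] * q^`().[z]) / q.[z] ^+ 2.
Proof.
move=> qz; have [dp vp] := is_derive_horner p z.
have [dq vq] := is_derive_horner q z.
rewrite /ratder derive1E.
rewrite (_ : ratval p q = horner p * (fun y => (q.[y])^-1)) //.
rewrite (deriveM dp (derivableV qz dq)) (deriveV qz dq).
by rewrite vp vq /GRing.scale /=; field.
Qed.

(** The two-variable Bezoutian of [p] and [q], its second variable specialised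
    to [a]. *)
Definition bezoutian (a : C) : {poly C} :=
  (q.[a] *: p - p.[a] *: q) %/ ('X - a%:P).

Lemma bezoutianK a :
  bezoutian a * ('X - a%:P) = q.[a] *: p - p.[a] *: q.
Proof.
apply/divpK; rewrite dvdp_XsubCl /root !hornerE.
by rewrite [p.[a] * _]mulrC subrr.
Qed.

Lemma size_bezoutian a : (size q <= size p)%N ->
  (size (bezoutian a) <= (size p).-1)%N.
Proof.
move=> szqp; rewrite size_divp ?polyXsubC_eq0 // size_XsubC /=.
rewrite -subn1 leq_sub2r //.
rewrite (leq_trans (size_polyD _ _)) // geq_max size_polyN.
by rewrite !(leq_trans (size_scale_leq _ _)).
Qed.

Lemma difference_quotientE a z : q.[a] != 0 -> q.[z] != 0 ->
  difference_quotient p q a z = (bezoutian a).[z] / q.[a] / q.[z].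
Proof.
move=> qa qz; rewrite /difference_quotient.
case: eqVneq => [->|neq_za].
  (* On the diagonal, differentiating [bezoutianK] at [a] gives the value of
     the Bezoutian there. *)
  have /(congr1 (fun f => f^`().[a])) := bezoutianK a.
  rewrite derivM derivXsubC derivB !derivZ !hornerE subrr mulr0 add0r => ->.
  by rewrite ratderE //; field.
have /(congr1 (fun f => f.[z])) := bezoutianK a.
rewrite !hornerE => /(canRL (mulfK _)) ->; last by rewrite subr_eq0.
by rewrite /ratval; field; rewrite qa qz subr_eq0.
Qed.

Lemma analytic_at_denominator a : analytic_at p q a -> q.[a] != 0.
Proof. by move=> /nbhs_singleton[]. Qed.

(** Each difference quotient is a Bezoutian divided by [q], up to a constant. *)
Lemma in_span_numerator f : (size q <= size p)%N -> in_span p q f ->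
  exists2 G : {poly C}, (size G <= (size p).-1)%N &
    forall z, q.[z] != 0 -> f z = G.[z] / q.[z].
Proof.
move=> szqp [s [s_an fE]].
exists (\sum_(ca <- s) (ca.1 / q.[ca.2]) *: bezoutian ca.2).
  apply: (leq_trans (size_sum _ _ _)); apply/bigmax_leqP_seq => ca _ _.
  exact: leq_trans (size_scale_leq _ _) (size_bezoutian _ _).
move=> z qz; rewrite fE // horner_sum mulr_suml; apply: eq_big_seq => ca ca_s.
have qa := analytic_at_denominator (s_an _ ca_s).
by rewrite difference_quotientE // hornerZ; field; rewrite qa qz.
Qed.

(** * Values at the solutions of [r(z) = alpha] *)

Section Level.
Variable alpha : C.
Let P := p - alpha *: q.

Lemma solutions_root z : solutions p q alpha z -> root P z.
Proof.
by move=> [qz rz]; rewrite /root /P !hornerE -rz /ratval divfK // subrr.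
Qed.

Lemma ratder_solutions z : solutions p q alpha z ->
  ratder p q z = P^`().[z] / q.[z].
Proof.
move=> [qz rz]; rewrite ratderE // derivB derivZ !hornerE.
have -> : p.[z] = alpha * q.[z] by rewrite -rz /ratval divfK.
by field.
Qed.

(** As [r z = alpha], the numerator of the difference quotient is
    [- P(b) / q(b)], and [P(b) / (b - z)] is the value at [b] of the cofactor.
    For [b = z] both sides are [r'(z)]. *)
Lemma difference_quotient_solutions b z : solutions p q alpha z -> q.[b] != 0 ->
  difference_quotient p q b z = (cofactor_at P z).[b] / q.[b].
Proof.
move=> sol_z qb; have root_z := solutions_root sol_z.
rewrite /difference_quotient; case: eqVneq => [<-|neq_zb].
  by rewrite horner_cofactor_at_deriv // ratder_solutions.
have /(congr1 (fun f => f.[b])) := cofactor_atK root_z.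
rewrite !hornerE => /(canRL (mulfK _)) ->; last by rewrite subr_eq0 eq_sym.
have -> : ratval p q z = alpha by case: sol_z.
rewrite /ratval; field.
by rewrite qb !subr_eq0 neq_zb eq_sym neq_zb.
Qed.

(** [p = alpha q] with [p], [q] coprime forces [p] to be constant. *)
Lemma level_poly_neq0 : coprimep p q -> (1 < size p)%N -> P != 0.
Proof.
move=> cpq szp; rewrite subr_eq0; apply: contraTneq szp => pE.
have q_dvd_p : q %| p by rewrite pE -mul_polyC dvdp_mull.
have /eqP szq : size q == 1%N by rewrite -coprimepp (coprimep_dvdr q_dvd_p).
by rewrite -leqNgt pE (leq_trans (size_scale_leq _ _)) // szq.
Qed.

(** The factors [q(w_i)] coming from [f], from the kernel and from [r'] cancel,
    which leaves the interpolation formula for the numerator of [f]. *)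
Lemma difference_quotient_reproducing (w : 'I_(size p).-1 -> C) f b :
  coprimep p q -> (size q <= size p)%N -> (1 < size p)%N ->
  injective w -> (forall i, solutions p q alpha (w i)) ->
  in_span p q f -> q.[b] != 0 ->
  \sum_i f (w i) * difference_quotient p q b (w i) / ratder p q (w i) = f b.
Proof.
move=> cpq szqp szp w_inj w_sol /(in_span_numerator szqp)[G szG fE] qb.
have P_neq0 := level_poly_neq0 cpq szp.
have w_root i := solutions_root (w_sol i).
have szP : (size P <= (size p).-1.+1)%N.
  rewrite (ltn_predK szp) (leq_trans (size_polyD _ _)) // geq_max size_polyN.
  by rewrite leqnn (leq_trans (size_scale_leq _ _)).
rewrite fE // (lagrange_interpolation_cofactor w_inj P_neq0 szP w_root b szG).
rewrite mulr_suml; apply: eq_bigr => i _; have [qw _] := w_sol i.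
have dP := deriv_neq0_at_roots w_inj P_neq0 szP w_root i.
rewrite fE // difference_quotient_solutions // ratder_solutions //.
by field; rewrite qb qw dP.
Qed.

End Level.

(** The reproducing property, extended by linearity in [g].  This evaluates the
    sum by an expression in which [alpha] no longer occurs. *)
Lemma sum_reproducing_span alpha (w : 'I_(size p).-1 -> C) f g
    (s : seq (C * C)) :
  coprimep p q -> (size q <= size p)%N -> (1 < size p)%N ->
  injective w -> (forall i, solutions p q alpha (w i)) ->
  in_span p q f -> (forall ca, ca \in s -> q.[ca.2] != 0) ->
  (forall z, q.[z] != 0 ->
    g z = \sum_(ca <- s) ca.1 * difference_quotient p q ca.2 z) ->
  \sum_i f (w i) * g (w i) / ratder p q (w i) = \sum_(ca <- s) ca.1 * f ca.2.
Proof.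
move=> cpq szqp szp w_inj w_sol f_span s_dom gE.
transitivity (\sum_i \sum_(ca <- s) ca.1 *
    (f (w i) * difference_quotient p q ca.2 (w i) / ratder p q (w i))).
  apply: eq_bigr => i _; have [qw _] := w_sol i.
  rewrite gE // mulr_sumr mulr_suml; apply: eq_bigr => ca _.
  by rewrite -!mulrA mulrCA.
rewrite exchange_big /=; apply: eq_big_seq => ca ca_s.
by rewrite -mulr_sumr (difference_quotient_reproducing cpq szqp szp w_inj w_sol)
  ?s_dom.
Qed.

End RationalFunction.

Theorem lemma3p1 (R : realType) (p q : {poly R[i]}) (N : nat)
  (hq : q != 0) (hpq : coprimep p q) (hdeg : (size q <= size p)%N)
  (hN : N = (size p).-1)
  (w : R[i] -> 'I_N -> R[i])
  (hinj : forall alpha, Omega p q alpha -> injective (w alpha))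
  (hw : forall alpha, Omega p q alpha -> range (w alpha) = solutions p q alpha)
  (f g : R[i] -> R[i]) (hf : in_span p q f) (hg : in_span p q g) :
  forall alpha beta, Omega p q alpha -> Omega p q beta ->
    \sum_(n < N) f (w alpha n) * g (w alpha n) / ratder p q (w alpha n)
    = \sum_(n < N) f (w beta n) * g (w beta n) / ratder p q (w beta n).
Proof.
move=> alpha beta Oalpha Obeta; subst N.
have [szp|szp] := leqP (size p) 1.
  (* Here [r] is constant and both sums are empty. *)
  have I0 : (size p).-1 = 0%N by case: (size p) szp => [|[]].
  have no_index (i : 'I_(size p).-1) : False by case: i => m; rewrite I0.
  by apply: eq_bigr => i; case: (no_index i).
case: hg => s [s_an gE].
have s_dom ca : ca \in s -> q.[ca.2] != 0.
  by move=> ca_s; apply: analytic_at_denominator (s_an _ ca_s).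
have w_sol gamma i : Omega p q gamma -> solutions p q gamma (w gamma i).
  by move=> Ogamma; rewrite -hw //; exists i.
have formE gamma (Ogamma : Omega p q gamma) :=
  sum_reproducing_span hpq hdeg szp (hinj _ Ogamma) (w_sol gamma ^~ Ogamma)
    hf s_dom gE.
exact: etrans (formE _ Oalpha) (esym (formE _ Obeta)).
Qed.
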